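(* If $m,n$ are integers with $3 \leq m \leq n$, then $\mathrm{dom}_t(P_m \Box P_n) \geq \frac{mn}{3}$.
   Context: An orientation of a (finite simple) graph $G$ is a digraph obtained by directing each edge $uv$ of $G$ in exactly one of the two directions $(u,v)$ or $(v,u)$. The orientation is valid if every vertex has in-degree at least $1$. A set $S\subseteq V(D)$ is a total dominating set of a digraph $D$ if every vertex of $D$ (including those in $S$) has an in-neighbor in $S$; $\gamma_t(D)$ is the minimum cardinality of a total dominating set of $D$. For a graph $G$ in which every component contains a cycle (equivalently, $G$ has a valid orientation), $\mathrm{dom}_t(G)$ is the minimum of $\gamma_t(D)$ over all valid orientations $D$ of $G$. $P_m$ is the path on $m$ vertices, and $G\Box H$ is the Cartesian product: vertex set $V(G)\times V(H)$, with $(g,h)$ adjacent to $(g',h')$ iff either $g=g'$ and $hh'\in E(H)$, or $gg'\in E(G)$ and $h=h'$. *)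

(* Defs.v *)
From mathcomp Require Import all_boot.

Set Implicit Arguments.
Unset Strict Implicit.
Unset Printing Implicit Defensive.

(* The value is 0 when no x satisfies P. *)
Definition min_val (T : finType) (P : pred T) (f : T -> nat) : nat :=
  if [pick x | P x] is Some x0 then f [arg min_(x < x0 | P x) f x] else 0.

Lemma min_valP (T : finType) (P : pred T) (f : T -> nat) :
  (exists x, P x) ->
  (exists2 x, P x & min_val P f = f x) /\ (forall y, P y -> min_val P f <= f y).
Proof.
case=> x Px; rewrite /min_val; case: pickP => [x0 Px0|/(_ x)]; last by rewrite Px.
by case: arg_minnP => // i Pi mi; split=> //; exists i.
Qed.

Record graph := Graph {
  vertex :> finType;
  edge : rel vertex;
  edge_sym : symmetric edge;
  edge_irr : irreflexive edge
}.

(* A digraph on T is given by its set of arcs; (u, v) is the arc from u to v. *)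
Definition digraph (T : finType) := {set T * T}.

Section Digraphs.
Variables (T : finType) (D : digraph T).

Definition in_nbhd (v : T) : {set T} := [set u | (u, v) \in D].

Definition in_degree (v : T) : nat := #|in_nbhd v|.

Definition total_dominating (S : {set T}) : bool :=
  [forall v, exists u in S, u \in in_nbhd v].

(* Some S is total dominating exactly when all in-degrees are positive
   (see [total_dominatingT]); otherwise gamma_t takes the value 0. *)
Definition gamma_t : nat := min_val total_dominating (fun S => #|S|).

Lemma total_dominatingT :
  total_dominating [set: T] = [forall v, 1 <= in_degree v].
Proof.
apply: eq_forallb => v; rewrite /in_degree card_gt0.
by apply/exists_inP/set0Pn => [[u _ Hu]|[u Hu]]; exists u; rewrite ?inE in Hu *.
Qed.

End Digraphs.

Section Orientations.
Variable G : graph.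

Definition orientation (D : digraph G) : bool :=
  [forall u, forall v,
     if edge u v then ((u, v) \in D) (+) ((v, u) \in D) else (u, v) \notin D].

Definition valid_orientation (D : digraph G) : bool :=
  orientation D && [forall v, 1 <= in_degree D v].

(* When G has no valid orientation, dom_t takes the value 0; a lower bound on
   dom_t therefore cannot hold by default. *)
Definition dom_t : nat := min_val valid_orientation (@gamma_t G).

End Orientations.

Section PathGraph.
Variable m : nat.

Definition path_edge : rel 'I_m := fun i j => (i.+1 == j) || (j.+1 == i).

Lemma path_edge_sym : symmetric path_edge.
Proof. by move=> i j; rewrite /path_edge orbC. Qed.

Lemma path_edge_irr : irreflexive path_edge.
Proof. by move=> i; rewrite /path_edge orbb; apply/eqP/nesym/n_Sn. Qed.

Definition path_graph : graph := Graph path_edge_sym path_edge_irr.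

End PathGraph.

Section CartesianProduct.
Variables G H : graph.

Definition box_edge : rel (G * H)%type := fun x y =>
  (x.1 == y.1) && edge x.2 y.2 || edge x.1 y.1 && (x.2 == y.2).

Lemma box_edge_sym : symmetric box_edge.
Proof.
by move=> x y; rewrite /box_edge ![x.1 == _]eq_sym ![x.2 == _]eq_sym
  (edge_sym x.1) (edge_sym x.2).
Qed.

Lemma box_edge_irr : irreflexive box_edge.
Proof. by move=> x; rewrite /box_edge !edge_irr andbF. Qed.

Definition box : graph := Graph box_edge_sym box_edge_irr.

End CartesianProduct.

(* Main.v *)
Require Import Defs.
From mathcomp Require Import all_boot all_order all_algebra zify.

Set Implicit Arguments.
Unset Strict Implicit.
Unset Printing Implicit Defensive.

(** In a valid orientation every vertex has an in-neighbor, so a vertex of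
degree at most k+1 has at most k out-neighbors.  The out-neighborhoods of the
members of a total dominating set cover all vertices, so such a set has at
least |V|/k elements ([card_le_dom_t]).  A grid has maximum degree at most 4,
whence k = 3.

The bound on dom_t is meaningful only if the grid does have a valid
orientation.  Choosing for every vertex v a neighbor p v that is to be its
in-neighbor is consistent as soon as p never swaps two vertices
([parent_valid_orientation]).  In the grid, p turns around the corner
4-cycle, and everywhere else moves towards that cycle ([grid_parent]). *)

Definition nbhd (G : graph) (u : G) : {set G} := [set v | edge u v].

Definition out_nbhd (T : finType) (D : digraph T) (u : T) : {set T} :=
  [set v | (u, v) \in D].

Lemma orientation_arc (G : graph) (D : digraph G) (u v : G) :
  orientation D -> (u, v) \in D -> edge u v /\ (v, u) \notin D.
Proof.
move=> /forallP/(_ u)/forallP/(_ v) + uvD; rewrite uvD.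
by case: ifP.
Qed.

(** An edge at u that carries an arc into u cannot carry one out of u. *)
Lemma card_out_nbhd_lt (G : graph) (D : digraph G) (u : G) :
  valid_orientation D -> #|out_nbhd D u| < #|nbhd u|.
Proof.
move=> /andP[orD /forallP/(_ u)]; rewrite card_gt0 => /set0Pn[w].
rewrite inE => wuD; have [wu uwD] := orientation_arc orD wuD.
apply: proper_card; apply/properP; split.
  by apply/subsetP=> v; rewrite !inE => /(orientation_arc orD)[].
by exists w; rewrite inE // edge_sym.
Qed.

Lemma card_le_total_dominating (T : finType) (D : digraph T) (S : {set T})
    (k : nat) :
  (forall u, #|out_nbhd D u| <= k) -> total_dominating D S -> #|T| <= k * #|S|.
Proof.
move=> outk /forallP domS; rewrite -cardsT mulnC -sum_nat_const.
apply: (@leq_trans (\sum_(u in S) #|out_nbhd D u|)); last exact: leq_sum.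
have -> : [set: T] = \bigcup_(u in S) out_nbhd D u.
  apply/setP=> v; rewrite inE; apply/esym/bigcupP.
  by have /exists_inP[u uS] := domS v; rewrite inE => uv; exists u; rewrite ?inE.
apply: (big_ind2 (fun (A : {set T}) a => #|A| <= a)) => // [|A a B b leA leB].
  by rewrite cards0.
exact: leq_trans (leq_card_setU A B) (leq_add leA leB).
Qed.

Lemma card_le_dom_t (G : graph) (k : nat) :
  (forall u : G, #|nbhd u| <= k.+1) ->
  (exists D : digraph G, valid_orientation D) -> #|G| <= k * dom_t G.
Proof.
move=> degk exD; rewrite /dom_t.
have [[D vD ->] _] := min_valP (@gamma_t G) exD.
have exS : exists S, total_dominating D S.
  by exists [set: G]; rewrite total_dominatingT; case/andP: vD.
rewrite /gamma_t; have [[S domS ->] _] := min_valP (fun S : {set G} => #|S|) exS.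
apply: card_le_total_dominating domS => u.
by rewrite -ltnS (leq_trans (card_out_nbhd_lt u vD)).
Qed.

Lemma card_nbhd_path (m : nat) (i : path_graph m) : #|nbhd i| <= 2.
Proof.
(* A neighbor of i is determined by the side of i on which it lies. *)
rewrite -card_bool -(@card_in_imset _ _ (fun j : 'I_m => i < j)) ?max_card //.
move=> j k; rewrite !inE /= /path_edge => ij ik eqside; apply: val_inj => /=.
lia.
Qed.

Lemma card_nbhd_box (G H : graph) (x : box G H) :
  #|nbhd x| <= #|nbhd x.1| + #|nbhd x.2|.
Proof.
have sub : nbhd x \subset
    [set (g, x.2) | g in nbhd x.1] :|: [set (x.1, h) | h in nbhd x.2].
  apply/subsetP=> -[g h]; rewrite !inE /= /box_edge /=.
  case/orP=> /andP[]; [move=> /eqP<- xh | move=> xg /eqP<-]; apply/orP.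
    by right; apply/imsetP; exists h; rewrite ?inE.
  by left; apply/imsetP; exists g; rewrite ?inE.
apply: leq_trans (subset_leq_card sub) _.
apply: leq_trans (leq_card_setU _ _) _.
by apply: leq_add; apply: leq_imset_card.
Qed.

(** The arcs (p v, v) give every vertex an in-neighbor; that p has no 2-cycle
says that no edge is directed both ways by them.  The other edges are directed
arbitrarily, here by the enumeration of the vertices. *)
Lemma parent_valid_orientation (G : graph) (p : G -> G) :
  (forall v, edge (p v) v) -> (forall v, p (p v) != v) ->
  exists D : digraph G, valid_orientation D.
Proof.
move=> pE p2.
pose arc u v := (u == p v) || (v != p u) && (enum_rank u < enum_rank v).
exists [set a | edge a.1 a.2 && arc a.1 a.2]; apply/andP; split; last first.
  apply/forallP=> v; rewrite card_gt0; apply/set0Pn; exists (p v).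
  by rewrite !inE /= pE /arc eqxx.
apply/forallP=> u; apply/forallP=> v; rewrite !inE /= [edge v u]edge_sym.
case: (boolP (edge u v)) => //= uv; rewrite /arc.
have [-> | _] := eqVneq u (p v); first by rewrite eq_sym (negPf (p2 v)).
have [//|_ /=] := eqVneq v (p u).
have neq : (enum_rank u : nat) != enum_rank v.
  apply: contraTneq uv => /ord_inj/enum_rank_inj->.
  by rewrite edge_irr.
by case: ltngtP neq.
Qed.

(** The corner square (0, 0), (1, 0), (1, 1), (0, 1) is a 4-cycle of this map,
so it contains no 2-cycle and is never left; at every vertex outside the square
the sum of the coordinates decreases, so there is no 2-cycle elsewhere. *)
Definition grid_parent (x : nat * nat) : nat * nat :=
  match x with
  | (0, 0) => (1, 0)
  | (1, 0) => (1, 1)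
  | (1, 1) => (0, 1)
  | (i.+1, 0) => (i, 0)
  | (i, j.+1) => (i, j)
  end.

Lemma grid_valid_orientation (m n : nat) : 1 < m -> 1 < n ->
  exists D : digraph (box (path_graph m) (path_graph n)), valid_orientation D.
Proof.
case: m n => [|[|m]] [|[|n]] // _ _.
pose G := box (path_graph m.+2) (path_graph n.+2).
pose coord (x : 'I_m.+2 * 'I_n.+2) : nat * nat := (val x.1, val x.2).
pose p (x : G) : G :=
  (inord (grid_parent (coord x)).1, inord (grid_parent (coord x)).2).
have inG i j : i < m.+2 -> j < n.+2 ->
    (grid_parent (i, j)).1 < m.+2 /\ (grid_parent (i, j)).2 < n.+2.
  by case: i j => [|[|i]] [|[|j]] //= im jn; split=> //; apply: ltnW.
have pE x : coord (p x) = grid_parent (coord x).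
  have [? ?] := inG _ _ (ltn_ord x.1) (ltn_ord x.2).
  by rewrite [LHS]/coord /= !inordK // -surjective_pairing.
apply: (@parent_valid_orientation G p) => x.
  (* Adjacency in the grid, read on natural coordinates. *)
  suff : let y := coord x in let z := coord (p x) in
    (z.1 == y.1) && ((z.2.+1 == y.2) || (y.2.+1 == z.2)) ||
    ((z.1.+1 == y.1) || (y.1.+1 == z.1)) && (z.2 == y.2) by [].
  rewrite pE; case: (coord x) => [[|[|i]] [|[|j]]] //=; lia.
apply/eqP=> /(congr1 coord); rewrite !pE.
by case: (coord x) => [[|[|[|i]]] [|[|[|j]]]] //= -[]; lia.
Qed.

Theorem theorem4p3 (m n : nat) (hm : 3 <= m) (hmn : m <= n) :
  ((m * n)%:R / 3%:R <= (dom_t (box (path_graph m) (path_graph n)))%:R :> rat)%R.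
Proof.
have m1 : 1 < m by apply: ltnW.
have n1 : 1 < n by apply: leq_trans m1 hmn.
rewrite Num.Theory.ler_pdivrMr // -GRing.natrM Num.Theory.ler_nat [leqRHS]mulnC.
have deg4 (x : box (path_graph m) (path_graph n)) : #|nbhd x| <= 4.
  apply: leq_trans (card_nbhd_box x) _.
  exact: (leq_add (card_nbhd_path _) (card_nbhd_path _)).
have := card_le_dom_t deg4 (grid_valid_orientation m1 n1).
by rewrite card_prod !card_ord.
Qed.
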